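(* Let $n \geq 1$, let $\mathbf{A}, \mathbf{B}$ be two positive definite $n \times n$ complex matrices and let $\mathbf{C}, \mathbf{D}$ be two positive semidefinite $n \times n$ complex matrices. Then $$\mathrm{Tr}\left\{(\mathbf{A}-\mathbf{B})(\mathbf{B}^{-1}-\mathbf{A}^{-1}) + (\mathbf{C}-\mathbf{D})\left[(\mathbf{B}+\mathbf{D})^{-1}-(\mathbf{A}+\mathbf{C})^{-1}\right]\right\} \geq 0.$$
   Context: Positive definite and positive semidefinite matrices are understood to be Hermitian. $\mathrm{Tr}$ denotes the trace. An inequality $\mathrm{Tr}\{\cdot\} \geq 0$ means that the trace is a nonnegative real number. *)

(* Defs.v *)
From mathcomp Require Import all_boot all_order all_algebra.

Set Implicit Arguments.
Unset Strict Implicit.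
Unset Printing Implicit Defensive.

Import Order.TTheory GRing.Theory Num.Theory.
Local Open Scope ring_scope.
Local Open Scope sesquilinear_scope.

(* On a numClosedFieldType the order is partial: [0 <= z] (resp. [0 < z]) means
   that z is real and nonnegative (resp. positive). *)

Definition posdefmx (C : numClosedFieldType) (n : nat) (A : 'M[C]_n) : Prop :=
  A \is hermsymmx /\
  forall x : 'cV[C]_n, x != 0 -> 0 < (x ^t* *m A *m x) 0 0.

Definition possemidefmx (C : numClosedFieldType) (n : nat) (A : 'M[C]_n) : Prop :=
  A \is hermsymmx /\
  forall x : 'cV[C]_n, 0 <= (x ^t* *m A *m x) 0 0.

(* Main.v *)
Require Import Defs.
From mathcomp Require Import all_boot all_order all_algebra.
From mathcomp Require Import reals complex ring.

Set Implicit Arguments.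
Unset Strict Implicit.
Unset Printing Implicit Defensive.

Import Order.TTheory GRing.Theory Num.Theory.
Local Open Scope ring_scope.

(** Write [P = A - B], [Q = C - D], [X = A + C], [Y = B + D].  Since
    [B^-1 - A^-1 = B^-1 P A^-1] and [Y^-1 - X^-1 = Y^-1 (P + Q) X^-1], the trace
    equals [tr (P B^-1 P A^-1) + <Q, Q> + <Q, P>] with
    [<S, T> = tr (S Y^-1 T X^-1)].  As inversion is antitone, the first term is
    at least [<P, P>].  Moreover [<Q, P> = <P, Q>] because
    [Y^-1 (X - Y) X^-1 = X^-1 (X - Y) Y^-1], so twice the trace is at least
    [<P + Q, P + Q> + <P, P> + <Q, Q>], a sum of traces of products of positive
    semidefinite matrices. *)

Section PositiveSemidefinite.

Local Open Scope sesquilinear_scope.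

Variable F : numClosedFieldType.

Lemma hermsymmxP n (A : 'M[F]_n) : reflect (A ^t* = A) (A \is hermsymmx).
Proof.
by rewrite is_hermitianmxE expr0 scale1r eq_sym; apply: eqP.
Qed.

Lemma trmxC_mul m n p (A : 'M[F]_(m, n)) (B : 'M[F]_(n, p)) :
  (A *m B) ^t* = B ^t* *m A ^t*.
Proof. by rewrite trmx_mul map_mxM. Qed.

Lemma trmxCD m n (A B : 'M[F]_(m, n)) : (A + B) ^t* = A ^t* + B ^t*.
Proof. by rewrite linearD map_mxD. Qed.

Lemma trmxCB m n (A B : 'M[F]_(m, n)) : (A - B) ^t* = A ^t* - B ^t*.
Proof. by rewrite linearB map_mxB. Qed.

Lemma hermsymmxB n (A B : 'M[F]_n) :
  A \is hermsymmx -> B \is hermsymmx -> A - B \is hermsymmx.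
Proof.
by move=> /hermsymmxP hA /hermsymmxP hB; apply/hermsymmxP; rewrite trmxCB hA hB.
Qed.

Lemma possemidefmxD n (A B : 'M[F]_n) :
  possemidefmx A -> possemidefmx B -> possemidefmx (A + B).
Proof.
move=> [/hermsymmxP hA pA] [/hermsymmxP hB pB]; split.
  by apply/hermsymmxP; rewrite trmxCD hA hB.
by move=> x; rewrite mulmxDr mulmxDl mxE addr_ge0.
Qed.

Lemma possemidefmx_congr m n (M : 'M[F]_m) (T : 'M[F]_(m, n)) :
  possemidefmx M -> possemidefmx (T ^t* *m M *m T).
Proof.
move=> [/hermsymmxP hM pM]; split.
  by apply/hermsymmxP; rewrite !trmxC_mul trmxCK hM mulmxA.
by move=> x; have := pM (T *m x); rewrite trmxC_mul !mulmxA.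
Qed.

Lemma possemidefmx_diag_ge0 n (M : 'M[F]_n) i : possemidefmx M -> 0 <= M i i.
Proof.
move=> [_ /(_ (delta_mx i 0))].
by rewrite trmx_delta map_delta_mx -mulmxA -colE -rowE !mxE.
Qed.

Lemma possemidefmx_mxtrace_mul_ge0 n (M N : 'M[F]_n) :
  possemidefmx M -> possemidefmx N -> 0 <= \tr (M *m N).
Proof.
move=> pM pN; have hN := pN.1.
set U := spectralmx N; set d := spectral_diag N.
have Uu : U \is unitarymx by exact: spectral_unitarymx.
have UUt : U *m U ^t* = 1%:M by apply/unitarymxP.
have defN : N = U ^t* *m diag_mx d *m U.
  by rewrite -invmx_unitary //; apply/orthomx_spectralP/hermitian_normalmx.
have pcongr K : possemidefmx K -> possemidefmx (U *m K *m U ^t*).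
  by move=> /(possemidefmx_congr (U ^t*)); rewrite trmxCK.
(* The eigenvalues are the diagonal entries of [U N U^*], a congruence of [N]. *)
have d_ge0 i : 0 <= d 0 i.
  have := possemidefmx_diag_ge0 i (pcongr _ pN).
  rewrite defN !mulmxA UUt mul1mx -mulmxA UUt mulmx1.
  by rewrite mxE eqxx mulr1n.
rewrite defN !mulmxA mxtrace_mulC !mulmxA mul_mx_diag.
apply: sumr_ge0 => i _; rewrite mxE mulr_ge0 //.
exact/possemidefmx_diag_ge0/pcongr.
Qed.

Lemma posdef_semidefmx n (A : 'M[F]_n) : posdefmx A -> possemidefmx A.
Proof.
move=> [hA pA]; split=> // x; have [->|x0] := eqVneq x 0.
  by rewrite mulmx0 mxE.
exact/ltW/pA.
Qed.

Lemma posdefmxDr n (A B : 'M[F]_n) :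
  posdefmx A -> possemidefmx B -> posdefmx (A + B).
Proof.
move=> pA pB; split.
  exact: (possemidefmxD (posdef_semidefmx pA) pB).1.
by move=> x x0; rewrite mulmxDr mulmxDl mxE ltr_wpDr ?pB.2 ?pA.2.
Qed.

Lemma posdefmx_unit n (A : 'M[F]_n) : posdefmx A -> A \in unitmx.
Proof.
move=> [_ pA]; rewrite -unitmx_tr -row_free_unit -kermx_eq0.
apply/rowV0P => v /sub_kermxP vA0; apply/eqP/contraT => v0.
have vT0 : v^T != 0 by rewrite trmx_eq0.
have := pA _ vT0.
by rewrite -mulmxA -[A]trmxK -trmx_mul vA0 trmx0 mulmx0 mxE ltxx.
Qed.

Lemma posdefmx_inv_herm n (A : 'M[F]_n) :
  posdefmx A -> (invmx A) ^t* = invmx A.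
Proof.
by move=> [/hermsymmxP hA _]; rewrite trmx_inv map_invmx hA.
Qed.

(** The inverse is a congruence of [A]: [A^-1 = (A^-1)^* A A^-1]. *)
Lemma possemidefmx_inv n (A : 'M[F]_n) : posdefmx A -> possemidefmx (invmx A).
Proof.
move=> pA; have := possemidefmx_congr (invmx A) (posdef_semidefmx pA).
by rewrite posdefmx_inv_herm // mulVmx ?posdefmx_unit // mul1mx.
Qed.

Lemma invmxB n (A B : 'M[F]_n) : A \in unitmx -> B \in unitmx ->
  invmx B - invmx A = invmx B *m (A - B) *m invmx A.
Proof.
by move=> uA uB; rewrite mulmxBr mulmxBl mulmxK // mulVmx // mul1mx.
Qed.

Lemma invmx_antitone n (A C : 'M[F]_n) : posdefmx A -> possemidefmx C ->
  possemidefmx (invmx A - invmx (A + C)).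
Proof.
move=> pA pC; have pX := posdefmxDr pA pC; set X := A + C in pX *.
have uA := posdefmx_unit pA; have uX := posdefmx_unit pX.
(* With [W = A^-1 - X^-1], the identity [W = W^* A W + (X^-1)^* C X^-1] shows [W] as a sum of two
   congruences; it follows by expanding with [C = X - A]. *)
suff -> : invmx A - invmx X =
    (invmx A - invmx X) ^t* *m A *m (invmx A - invmx X)
    + (invmx X) ^t* *m C *m invmx X.
  apply: possemidefmxD; last exact: possemidefmx_congr.
  exact/possemidefmx_congr/posdef_semidefmx.
rewrite trmxCB !posdefmx_inv_herm // -[C](addKr A) -/X.
rewrite mulmxBl mulVmx // mulmxBl mul1mx mulmxBr mulmxK //.
rewrite mulmxDr mulVmx // mulmxDl mul1mx mulmxN mulNmx.
by rewrite [- _ + _]addrC subrK.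
Qed.

Lemma mxtrace_herm_congr_ge0 n (P M N : 'M[F]_n) : P \is hermsymmx ->
  possemidefmx M -> possemidefmx N -> 0 <= \tr (P *m M *m P *m N).
Proof.
move=> /hermsymmxP hP pM; apply: possemidefmx_mxtrace_mul_ge0.
by rewrite -{1}hP; apply: possemidefmx_congr.
Qed.

Lemma mxtrace_herm_congr_mono n (P M M' N N' : 'M[F]_n) : P \is hermsymmx ->
  possemidefmx M -> possemidefmx N' ->
  possemidefmx (M' - M) -> possemidefmx (N' - N) ->
  \tr (P *m M *m P *m N) <= \tr (P *m M' *m P *m N').
Proof.
move=> hP pM pN' lM lN.
(* Changing one factor at a time, the differences are the traces of [P M P (N' - N)] and
   [P (M' - M) P N']. *)
apply: (@le_trans _ _ (\tr (P *m M *m P *m N'))); rewrite -subr_ge0 -linearB /=.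
  by rewrite -mulmxBr mxtrace_herm_congr_ge0.
by rewrite -!mulmxBl -mulmxBr mxtrace_herm_congr_ge0.
Qed.

(** After cycling, both sides are the trace of [Q (Y^-1 - X^-1)], the difference of inverses being
    factored in its two possible orders. *)
Lemma mxtrace_inv_sym n (X Y Q : 'M[F]_n) : X \in unitmx -> Y \in unitmx ->
  \tr (Q *m invmx Y *m (X - Y) *m invmx X)
  = \tr ((X - Y) *m invmx Y *m Q *m invmx X).
Proof.
move=> uX uY.
rewrite -[RHS]mxtrace_mulC !mulmxA -[RHS]mxtrace_mulC !mulmxA.
rewrite -!mulmxA ![invmx _ *m (_ *m _)]mulmxA -invmxB //.
by rewrite -[X - Y]opprB mulmxN mulNmx -invmxB // opprB.
Qed.

Lemma mxtrace_posdef_inv_ge0 n (A B C D : 'M[F]_n) :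
  posdefmx A -> posdefmx B -> possemidefmx C -> possemidefmx D ->
  0 <= \tr ((A - B) *m (invmx B - invmx A)
            + (C - D) *m (invmx (B + D) - invmx (A + C))).
Proof.
move=> pA pB pC pD.
have pX := posdefmxDr pA pC; have pY := posdefmxDr pB pD.
have lA := invmx_antitone pA pC; have lB := invmx_antitone pB pD.
have uX := posdefmx_unit pX; have uY := posdefmx_unit pY.
have defXY : A + C - (B + D) = (A - B) + (C - D) by rewrite opprD addrACA.
have hP := hermsymmxB pA.1 pB.1; have hQ := hermsymmxB pC.1 pD.1.
have hR := hermsymmxB pX.1 pY.1.
have iX := possemidefmx_inv pX; have iY := possemidefmx_inv pY.
have leP := mxtrace_herm_congr_mono hP iY (possemidefmx_inv pA) lB lA.
have P_ge0 := mxtrace_herm_congr_ge0 hP iY iX.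
have Q_ge0 := mxtrace_herm_congr_ge0 hQ iY iX.
have R_ge0 := mxtrace_herm_congr_ge0 hR iY iX.
have sym := mxtrace_inv_sym (C - D) uX uY.
rewrite linearD /= !invmxB ?posdefmx_unit // !mulmxA.
rewrite defXY in sym R_ge0 *.
set P := A - B in sym leP P_ge0 Q_ge0 R_ge0 *.
set Q := C - D in sym leP P_ge0 Q_ge0 R_ge0 *.
clearbody P Q.
pose f S T := \tr (S *m invmx (B + D) *m T *m invmx (A + C)).
have fDl S S' T : f (S + S') T = f S T + f S' T.
  by rewrite /f !mulmxDl linearD.
have fDr S T T' : f S (T + T') = f S T + f S T'.
  by rewrite /f mulmxDr mulmxDl linearD.
rewrite -!/(f _ _) in sym leP P_ge0 Q_ge0 R_ge0 *.
(* Since [X - Y = P + Q], [sym] says [f Q (P + Q) = f (P + Q) Q]; cancelling [f Q Q] leaves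
   [f Q P = f P Q]. *)
rewrite fDl fDr in sym; have QP := addIr _ sym.
rewrite fDl !fDr QP in R_ge0.
apply: le_trans (_ : f P P + (f Q P + f Q Q) <= _); last first.
  by rewrite fDr lerD2r.
(* The cross term [f P Q] has no known sign; doubling supplies the two copies that
   [f (P + Q) (P + Q)] absorbs. *)
rewrite -(pmulrn_lge0 _ (isT : (0 < 2)%N)) QP.
have -> : (f P P + (f P Q + f Q Q)) *+ 2 =
    f P P + f P Q + (f P Q + f Q Q) + f P P + f Q Q by ring.
by rewrite addr_ge0 // addr_ge0.
Qed.

End PositiveSemidefinite.

Theorem theorem1p1 (R : realType) (n : nat) (hn : (1 <= n)%N)
    (A B C D : 'M[R[i]]_n)
    (hA : posdefmx A) (hB : posdefmx B)
    (hC : possemidefmx C) (hD : possemidefmx D) :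
  0 <= \tr ((A - B) *m (invmx B - invmx A)
            + (C - D) *m (invmx (B + D) - invmx (A + C))).
Proof. exact: mxtrace_posdef_inv_ge0. Qed.
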